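(* Let $\alpha_1,\alpha_2\in[0,\pi/2)$, let $X\in\mathbb{M}^s_{n,\alpha_1}$ and $Y\in\mathbb{M}^s_{n,\alpha_2}$. Then $$\omega(XY)\le \sec(\alpha_1)\sec(\alpha_2)\,\omega(X)\,\omega(Y).$$
   Context: $\mathbb{M}_n$ is the algebra of all $n\times n$ complex matrices. The numerical range of $X\in\mathbb{M}_n$ is $W(X)=\{\langle Xx,x\rangle : x\in\mathbb{C}^n,\ \|x\|=1\}$, with the standard inner product and Euclidean norm on $\mathbb{C}^n$, and the numerical radius is $\omega(X)=\sup\{|z| : z\in W(X)\}$. For $\alpha\in[0,\pi/2)$ let $S_\alpha=\{z\in\mathbb{C} : \operatorname{Re}(z)>0,\ |\operatorname{Im}(z)|\le\tan(\alpha)\operatorname{Re}(z)\}$, and let $\mathbb{M}^s_{n,\alpha}$ be the class of all $X\in\mathbb{M}_n$ such that $W(zX)\subset S_\alpha$ for some $z\in\mathbb{C}$ with $|z|=1$. *)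

(* Defs.v *)
From HB Require Import structures.
From mathcomp Require Import all_boot all_order all_algebra.
From mathcomp Require Import complex.
From mathcomp Require Import all_classical all_reals all_analysis.

Set Implicit Arguments.
Unset Strict Implicit.
Unset Printing Implicit Defensive.

Import Order.TTheory GRing.Theory Num.Theory.

Local Open Scope classical_set_scope.
Local Open Scope ring_scope.

(* [dotmx] acts on row vectors, [dotmx u v = (u *m v ^t conj) 0 0], hence the
   transposes: [inner x y = \sum_i x i 0 * (y i 0)^*]. *)
Definition inner (R : realType) (n : nat) (x y : 'cV[R[i]]_n) : R[i] :=
  dotmx x^T y^T.

Definition euclidean_norm (R : realType) (n : nat) (x : 'cV[R[i]]_n) : R[i] :=
  sqrtC (inner x x).

Definition numrange (R : realType) (n : nat) (X : 'M[R[i]]_n) : set R[i] :=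
  [set inner (X *m x) x | x in [set x : 'cV[R[i]]_n | euclidean_norm x = 1]].

(* The modulus [`|z|] is a nonnegative real element of [R[i]]; its real part
   is that number in [R], where [sup] is taken. *)
Definition numradius (R : realType) (n : nat) (X : 'M[R[i]]_n) : R :=
  sup [set complex.Re `|z| | z in numrange X].

Definition sector (R : realType) (alpha : R) : set R[i] :=
  [set z | 0 < complex.Re z /\ `|complex.Im z| <= tan alpha * complex.Re z].

Definition sectorial (R : realType) (n : nat) (alpha : R) : set 'M[R[i]]_n :=
  [set X | exists z : R[i], `|z| = 1 /\ numrange (z *: X) `<=` sector alpha].

Definition sec (R : realType) (alpha : R) : R := (cos alpha)^-1.

(* Main.v *)
Require Import Defs.
From HB Require Import structures.
From mathcomp Require Import all_boot all_order all_algebra.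
From mathcomp Require Import complex.
From mathcomp Require Import all_classical all_reals all_analysis.
From mathcomp Require Import ring lra.

(* The claim follows from [omega(XY) <= ||XY|| <= ||X|| ||Y||] and the bound
   [||X|| <= sec(alpha) omega(X)] for sectorial [X]. For the latter, rotate [X]
   to [A = H + iK] with [H > 0] and [|K| <= tan(alpha) H]. Writing
   [A x = H u] with [u = x + i H^-1 K x] gives
   [<Hu,u> <= (1 + tan(alpha)^2) <Hx,x> = sec(alpha)^2 <Hx,x>], while
   [0 <= H <= omega(X)] gives [||Hu||^2 <= omega(X) <Hu,u>]. *)

Import Order.TTheory GRing.Theory Num.Theory.

Local Open Scope classical_set_scope.
Local Open Scope ring_scope.

(** * Sesquilinear algebra of the inner product and real quadratic forms *)

Section InnerProduct.
Context {R : realType} {n : nat}.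
Implicit Types (x y z : 'cV[R[i]]_n) (A H K : 'M[R[i]]_n) (a : R).

Lemma innerE x y : inner x y = \sum_i x i 0 * (y i 0)^*.
Proof. by rewrite /inner dotmxE mxE; apply: eq_bigr => i _; rewrite !mxE. Qed.

Lemma innerC x y : inner x y = (inner y x)^*.
Proof.
rewrite !innerE rmorph_sum; apply: eq_bigr => i _.
by rewrite rmorphM /= conjCK mulrC.
Qed.

Lemma innerDl x y z : inner (x + y) z = inner x z + inner y z.
Proof. by rewrite !innerE -big_split; apply: eq_bigr => i _; rewrite mxE mulrDl. Qed.

Lemma innerZl c x y : inner (c *: x) y = c * inner x y.
Proof. by rewrite !innerE mulr_sumr; apply: eq_bigr => i _; rewrite mxE mulrA. Qed.

Lemma innerBl x y z : inner (x - y) z = inner x z - inner y z.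
Proof.
by rewrite !innerE -sumrB; apply: eq_bigr => i _; rewrite !mxE mulrBl.
Qed.

Lemma innerZr c x y : inner x (c *: y) = c^* * inner x y.
Proof. by rewrite innerC innerZl rmorphM /= -innerC. Qed.

Lemma innerDr x y z : inner x (y + z) = inner x y + inner x z.
Proof. by rewrite innerC innerDl rmorphD /= [inner x y]innerC [inner x z]innerC. Qed.

Lemma inner0l y : inner 0 y = 0.
Proof. by rewrite -(scale0r 0) innerZl mul0r. Qed.

Definition adjmx A : 'M[R[i]]_n := map_mx Num.conj A^T.

Lemma inner_adjmxr A x y : inner x (adjmx A *m y) = inner (A *m x) y.
Proof.
symmetry; rewrite !innerE; under eq_bigr do rewrite mxE mulr_suml.
rewrite exchange_big; apply: eq_bigr => j _; rewrite mxE rmorph_sum mulr_sumr.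
by apply: eq_bigr => i _; rewrite !mxE rmorphM /= conjCK mulrCA mulrA.
Qed.

Lemma inner_adjmxl A x y : inner (adjmx A *m x) y = inner x (A *m y).
Proof. by rewrite innerC inner_adjmxr -innerC. Qed.

Lemma inner_gt0 x : x != 0 -> 0 < inner x x.
Proof. by move=> x0; rewrite dnorm_gt0 trmx_eq0. Qed.

Lemma inner_CauchySchwarz x y : `|inner x y| ^+ 2 <= inner x x * inner y y.
Proof. by case: (CauchySchwarz (@dotmx R[i] n) x^T y^T). Qed.

(** Quadratic forms are compared in the ordered field [R], where [lra] applies, rather than in
    [R[i]]. *)
Definition rdot x y : R := complex.Re (inner x y).

Lemma ReD (c d : R[i]) : complex.Re (c + d) = complex.Re c + complex.Re d.
Proof. by case: c d => ? ? []. Qed.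

Lemma ReZ a (c : R[i]) : complex.Re (a%:C%C * c) = a * complex.Re c.
Proof. by case: c => ? ? /=; rewrite mul0r subr0. Qed.

Lemma ReJ (c : R[i]) : complex.Re c^* = complex.Re c.
Proof. by case: c. Qed.

Lemma conjC_realc a : (a%:C%C)^* = a%:C%C :> R[i].
Proof. exact: conjc_real. Qed.

Lemma rdot_gt0 x : x != 0 -> 0 < rdot x x.
Proof. by move/inner_gt0; rewrite ltcE => /andP[]. Qed.

Lemma inner_rdot x : inner x x = (rdot x x)%:C%C.
Proof.
have [->|/inner_gt0/ltW/ger0_Im] := eqVneq x 0; first by rewrite /rdot inner0l.
by rewrite /rdot; case: (inner x x) => a b /= ->.
Qed.

Lemma rdot_ge0 x : 0 <= rdot x x.
Proof.
have [->|/rdot_gt0/ltW//] := eqVneq x 0; by rewrite /rdot inner0l.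
Qed.

Definition selfadjoint A := forall x y, inner (A *m x) y = inner x (A *m y).

(** Self-adjointness makes the two cross terms conjugate, so their real parts coincide. The vector
    [v] is given by an equation so that it can stay opaque in later rewriting. *)
Lemma rdot_quad A a b x y v : selfadjoint A -> v = a%:C%C *: x + b%:C%C *: y ->
  rdot (A *m v) v = a ^+ 2 * rdot (A *m x) x + 2 * a * b * rdot (A *m x) y
                    + b ^+ 2 * rdot (A *m y) y.
Proof.
move=> sA ->; rewrite /rdot mulmxDr -!scalemxAr !innerDl !innerDr.
rewrite !innerZl !innerZr !conjC_realc.
have -> : inner (A *m y) x = (inner (A *m x) y)^* by rewrite sA innerC.
move: (inner _ _) (inner _ _) (inner _ _) => p q r.
rewrite !ReD !ReZ ReJ.
ring.
Qed.

(** A nonzero kernel vector would make the quadratic form vanish. *)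
Lemma pos_unitmx A : (forall x, x != 0 -> 0 < rdot (A *m x) x) -> A \in unitmx.
Proof.
move=> Apos; rewrite unitmxE unitfE -det_tr; apply/det0P => -[v v0 vA].
have := Apos v^T; rewrite trmx_eq0 => /(_ v0).
by rewrite -[A]trmxK -trmx_mul vA trmx0 /rdot inner0l ltxx.
Qed.

(** This is $H^2 \le wH$ for $0 \le H \le w$, obtained without square roots of matrices: expand
    $\langle Hv,v\rangle \ge 0$ at $v = wx - Hx$, bound $\langle H(Hx),Hx\rangle$ by $w\|Hx\|^2$,
    and divide by $w$. *)
Lemma rdot_psd_sqr H (w : R) x : selfadjoint H -> 0 < w ->
  (forall y, 0 <= rdot (H *m y) y) -> (forall y, rdot (H *m y) y <= w * rdot y y) ->
  rdot (H *m x) (H *m x) <= w * rdot (H *m x) x.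
Proof.
move=> sH w0 H0 /(_ (H *m x)) Hw.
have [v vE] : exists v, v = w%:C%C *: x + (-1)%:C%C *: (H *m x) by eexists.
have := H0 v; rewrite (rdot_quad _ _ _ _ _ _ sH vE).
move: Hw; move: (rdot _ _) (rdot _ _) (rdot _ _) => p q r h1 h2.
by rewrite -(ler_pM2l w0); clear -h1 h2; lra.
Qed.

(* For [H z = K x], the cross terms of [<H (x + i z), x + i z>] cancel because
   [<H z, x> = <K x, x>] is real. *)
Lemma rdot_mulmx_le H K (t w : R) x :
  selfadjoint H -> selfadjoint K -> 0 <= t ->
  (forall y, y != 0 -> 0 < rdot (H *m y) y) ->
  (forall y, `|rdot (K *m y) y| <= t * rdot (H *m y) y) ->
  (forall y, rdot (H *m y) y <= w * rdot y y) ->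
  rdot ((H + 'i *: K) *m x) ((H + 'i *: K) *m x) <= (1 + t ^+ 2) * w ^+ 2 * rdot x x.
Proof.
move=> sH sK t0 Hpos KH Hw.
have [->|x0] := eqVneq x 0; first by rewrite mulmx0 /rdot inner0l mulr0.
have H0 y : 0 <= rdot (H *m y) y.
  by have [->|/Hpos/ltW//] := eqVneq y 0; rewrite mulmx0 /rdot inner0l.
have w0 : 0 < w.
  by rewrite -(pmulr_lgt0 _ (rdot_gt0 _ x0)); exact: lt_le_trans (Hpos x x0) (Hw x).
(* Definiteness makes [H] invertible; $z = H^{-1}Kx$ yields the factorization $Ax = H(x + iz)$. *)
have [z Hz] : exists z, H *m z = K *m x.
  by exists (invmx H *m (K *m x)); rewrite mulKVmx// pos_unitmx.
pose u := x + 'i *: z.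
set A := H + 'i *: K; have Au : A *m x = H *m u.
  by rewrite mulmxDl mulmxDr -scalemxAl -scalemxAr Hz.
have Hu : rdot (H *m u) u = rdot (H *m x) x + rdot (H *m z) z.
  rewrite /rdot -ReD; congr complex.Re.
  rewrite mulmxDr -scalemxAr innerDl !innerDr !innerZl !innerZr.
  have -> : inner (H *m x) z = inner (H *m z) x by rewrite sH Hz sK.
  rewrite conjCi mulrA mulrN -expr2 sqrCi opprK mul1r mulNr.
  move: (inner _ _) (inner _ _) (inner _ _) => p q r; ring.
have zx : rdot (H *m z) z <= t ^+ 2 * rdot (H *m x) x.
  (* Polarization: subtracting the [K]-forms at $sx + z$ and $sx - z$ leaves $4s\langle Kx,z\rangle
     = 4s\langle Hz,z\rangle$ (real parts), while the [H]-forms add up to $2(s^2\langle Hx,x\rangle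
     + \langle Hz,z\rangle)$. *)
  have polar s : 2 * s * rdot (H *m z) z
                 <= t * (s ^+ 2 * rdot (H *m x) x + rdot (H *m z) z).
    have [v vE] : exists v, v = s%:C%C *: x + 1%:C%C *: z by eexists.
    have [v' v'E] : exists v', v' = s%:C%C *: x + (-1)%:C%C *: z.
      by eexists; reflexivity.
    have := KH v; rewrite (rdot_quad _ _ _ _ _ _ sH vE) (rdot_quad _ _ _ _ _ _ sK vE).
    have := KH v'; rewrite (rdot_quad _ _ _ _ _ _ sH v'E) (rdot_quad _ _ _ _ _ _ sK v'E).
    rewrite -Hz !ler_norml => /andP[K1 _] /andP[_ K2].
    move: K1 K2.
    move: (rdot _ _) (rdot _ _) (rdot _ _) (rdot _ _) (rdot _ _) => a b c d e K1 K2.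
    by clear -K1 K2; lra.
  (* The choice $s = t$ gives the claim after division by $t$; for $t = 0$, $s = 1$ forces $\langle
     Hz,z\rangle \le 0$. *)
  have [t00|tneq] := eqVneq t 0.
    by have := polar 1; rewrite t00; move: (rdot _ _) (rdot _ _) => p q; clear -p; lra.
  have tgt : 0 < t by rewrite lt_def tneq.
  by rewrite -(ler_pM2l tgt); have := polar t; move: (rdot _ _) (rdot _ _) => p q; clear -p; lra.
apply: (@le_trans _ _ (w * rdot (H *m u) u)); first by rewrite Au; exact: rdot_psd_sqr.
rewrite Hu.
rewrite (_ : _ * rdot x x = w * ((1 + t ^+ 2) * (w * rdot x x))); last by clear; ring.
rewrite ler_pM2l//.
apply: (@le_trans _ _ ((1 + t ^+ 2) * rdot (H *m x) x)).
  by rewrite mulrDl mul1r lerD2l.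
exact: (ler_wpM2l (addr_ge0 ler01 (sqr_ge0 t)) (Hw x)).
Qed.

End InnerProduct.

(** * Moduli, the numerical radius and sectorial matrices *)

Section NumericalRadius.
Context {R : realType} {n : nat}.
Implicit Types (x y z : 'cV[R[i]]_n) (A X : 'M[R[i]]_n).

Lemma Re_norm_ge0 (c : R[i]) : 0 <= complex.Re `|c|.
Proof. by rewrite normc_def sqrtr_ge0. Qed.

Lemma normRe (c : R[i]) : `|c| = (complex.Re `|c|)%:C%C.
Proof. by rewrite normc_def. Qed.

Lemma Re_le_norm (c : R[i]) : complex.Re c <= complex.Re `|c|.
Proof.
rewrite normc_def /=; apply: le_trans (ler_norm _) _.
by rewrite -sqrtr_sqr ler_sqrt ?lerDl ?sqr_ge0// addr_ge0 ?sqr_ge0.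
Qed.

Lemma Re_norm_sum (I : finType) (F : I -> R[i]) :
  complex.Re `|\sum_i F i| <= \sum_i complex.Re `|F i|.
Proof.
rewrite -lecR -normRe rmorph_sum /=; apply: le_trans (ler_norm_sum _ _ _) _.
by apply: ler_sum => i _; rewrite normRe.
Qed.

Lemma unit_vector_entry_le1 x i : euclidean_norm x = 1 -> `|x i 0| <= 1.
Proof.
move=> /(congr1 (fun c => c ^+ 2)); rewrite sqrtCK expr1n => x1.
rewrite -(@expr_le1 _ 2)// -x1 innerE (bigD1 i)//= -normCK lerDl sumr_ge0// => j _.
by rewrite -normCK exprn_ge0.
Qed.

(** Entrywise form of the Cartesian decomposition $A = H + iK$, with [b] the corresponding entry of
    the adjoint. *)
Lemma half_sum_diff (C : numClosedFieldType) (a b : C) :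
  a = 2^-1 * (a + b) + 'i * (2^-1 * - 'i * (a - b)).
Proof.
rewrite (_ : 'i * _ = - 'i ^+ 2 * (2^-1 * (a - b))); last by ring.
by rewrite sqrCi; field.
Qed.

Lemma Re_half_addJ (c : R[i]) : complex.Re (2^-1 * (c + c^*)) = complex.Re c.
Proof.
rewrite (_ : 2^-1 = (2^-1)%:C%C) ?ReZ ?ReD ?ReJ; first by lra.
by rewrite fmorphV rmorph_nat.
Qed.

Lemma Im_half_subJ (c : R[i]) :
  complex.Re (2^-1 * - 'i * (c - c^*)) = complex.Im c.
Proof.
rewrite -mulrA (_ : 2^-1 = (2^-1)%:C%C) ?ReZ; last by rewrite fmorphV rmorph_nat.
by rewrite -complexiE; case: c => a b /=; lra.
Qed.

Lemma half_addJ_conj (C : numClosedFieldType) (a b : C) :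
  2^-1 * (a + b^*) = (2^-1 * (b + a^*))^*.
Proof. by rewrite rmorphM fmorphV rmorph_nat rmorphD /= conjCK addrC. Qed.

Lemma half_subJ_conj (C : numClosedFieldType) (a b : C) :
  2^-1 * - 'i * (a - b^*) = (2^-1 * - 'i * (b - a^*))^*.
Proof.
rewrite !rmorphM fmorphV rmorph_nat rmorphN rmorphB /= conjCK conjCi opprK.
by ring.
Qed.

Lemma ImZ (a : R) (c : R[i]) : complex.Im (a%:C%C * c) = a * complex.Im c.
Proof. by case: c => ? ? /=; rewrite mul0r addr0. Qed.

(** Coordinates of a unit vector have modulus at most 1, so the sum of the moduli of all entries is
    a bound. This makes the [sup] in [numradius] a genuine upper bound. *)
Lemma numrange_bounded X : has_ubound [set complex.Re `|z| | z in numrange X].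
Proof.
exists (\sum_i \sum_j complex.Re `|X i j|) => _ [_ [x /= x1 <-] <-].
rewrite innerE; apply: le_trans (Re_norm_sum _ _) _; apply: ler_sum => i _.
rewrite mxE mulr_suml; apply: le_trans (Re_norm_sum _ _) _; apply: ler_sum => j _.
rewrite -lecR -!normRe 2!normrM norm_conjC -mulrA ler_piMr//.
by rewrite mulr_ile1// unit_vector_entry_le1.
Qed.

Lemma numradius_ge0 X : 0 <= numradius X.
Proof.
rewrite /numradius.
(* The numerical range is empty when [n = 0]; [sup] is then 0 by convention. *)
have [[_ [c Xc _]]|/nonemptyPn ->] :=
  pselect ([set complex.Re `|z| | z in numrange X] !=set0); last by rewrite sup0.
apply: le_trans (Re_norm_ge0 c) _; apply: ub_le_sup (numrange_bounded X) _ _.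
by exists c.
Qed.

(** Normalizing [x] carries facts about unit vectors over to all nonzero vectors. *)
Lemma numrange_homogeneous X x : x != 0 ->
  exists2 c, numrange X c & inner (X *m x) x = (rdot x x)%:C%C * c.
Proof.
move=> x0; have xx := inner_gt0 _ x0.
pose s := sqrtC (inner x x).
have s0 : s != 0 by rewrite sqrtC_eq0 gt_eqF.
have ss : s ^+ 2 = inner x x by rewrite sqrtCK.
have sJ : s^* = s by rewrite geC0_conj// sqrtC_ge0 ltW.
have sVJ : (s^-1)^* = s^-1 by rewrite fmorphV /= sJ.
exists (inner (X *m (s^-1 *: x)) (s^-1 *: x)).
  exists (s^-1 *: x); last exact: erefl.
  change (euclidean_norm (s^-1 *: x) = 1).
  rewrite /euclidean_norm innerZl innerZr sVJ -ss.
  by rewrite expr2 mulKf// mulVf// sqrtC1.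
by rewrite -scalemxAr innerZl innerZr sVJ -inner_rdot -ss expr2; field.
Qed.

Lemma inner_mulmx_le_numradius X x :
  complex.Re `|inner (X *m x) x| <= numradius X * rdot x x.
Proof.
have [->|x0] := eqVneq x 0.
  by rewrite mulmx0 /rdot inner0l normr0 mulr0.
have [c Xc ->] := numrange_homogeneous X x x0.
rewrite normrM [`|_%:C%C|]ger0_norm ?ler0c ?rdot_ge0// ReZ mulrC.
rewrite ler_wpM2r ?rdot_ge0//; apply: ub_le_sup (numrange_bounded X) _ _.
by exists c.
Qed.

Lemma rdot_mulmx_le_of_sector A (t w : R) x : 0 <= t ->
  (forall y, y != 0 -> 0 < complex.Re (inner (A *m y) y)) ->
  (forall y, `|complex.Im (inner (A *m y) y)| <= t * complex.Re (inner (A *m y) y)) ->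
  (forall y, complex.Re (inner (A *m y) y) <= w * rdot y y) ->
  rdot (A *m x) (A *m x) <= (1 + t ^+ 2) * w ^+ 2 * rdot x x.
Proof.
move=> t0 Apos Asec Aw.
pose H := 2^-1 *: (A + adjmx A).
pose K := (2^-1 * - 'i) *: (A - adjmx A).
have AHK : A = H + 'i *: K.
  by apply/matrixP => i j; rewrite !mxE; exact: half_sum_diff.
have HE u v : inner (H *m u) v = 2^-1 * (inner (A *m u) v + inner u (A *m v)).
  by rewrite -scalemxAl mulmxDl innerZl innerDl (inner_adjmxl A u v).
have KE u v : inner (K *m u) v = 2^-1 * - 'i * (inner (A *m u) v - inner u (A *m v)).
  by rewrite -scalemxAl mulmxBl innerZl innerBl (inner_adjmxl A u v).
have sH : selfadjoint H.
  move=> u v; rewrite (innerC u (H *m v)) !HE (innerC u (A *m v)) (innerC v (A *m u)).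
  exact: half_addJ_conj.
have sK : selfadjoint K.
  move=> u v; rewrite (innerC u (K *m v)) !KE (innerC u (A *m v)) (innerC v (A *m u)).
  exact: half_subJ_conj.
have ReH y : rdot (H *m y) y = complex.Re (inner (A *m y) y).
  by rewrite /rdot HE (innerC y (A *m y)) Re_half_addJ.
have ImK y : rdot (K *m y) y = complex.Im (inner (A *m y) y).
  by rewrite /rdot KE (innerC y (A *m y)) Im_half_subJ.
clearbody H K; rewrite AHK; apply: rdot_mulmx_le sH sK t0 _ _ _ => y.
- by rewrite ReH; exact: Apos.
- by rewrite ReH ImK; exact: Asec.
- by rewrite ReH; exact: Aw.
Qed.

Lemma cos_gt0_quadrant (alpha : R) : 0 <= alpha < pi / 2 -> 0 < cos alpha.
Proof.
move=> /andP[alpha0 alpha_pi]; apply: cos_gt0_pihalf; rewrite alpha_pi andbT.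
by rewrite (lt_le_trans _ alpha0)// oppr_lt0 divr_gt0 ?pi_gt0.
Qed.

(** The unimodular factor that rotates [X] into the sector preserves $\|Xx\|$ and $|\langle
    Xx,x\rangle|$, so the estimate for the rotated matrix, with $1 + \tan^2 = \sec^2$, transfers to
    [X]. *)
Lemma sectorial_rdot_mulmx_le (alpha : R) X x :
  0 <= alpha < pi / 2 -> sectorial alpha X ->
  rdot (X *m x) (X *m x) <= (sec alpha * numradius X) ^+ 2 * rdot x x.
Proof.
move=> /andP[alpha0 alpha_pi] [z [z1 sX]].
have cos0 : 0 < cos alpha by apply: cos_gt0_quadrant; rewrite alpha0.
have tan0 : 0 <= tan alpha.
  rewrite /tan divr_ge0 ?(ltW cos0)// sin_ge0_pi// alpha0/=.
  by rewrite (le_trans (ltW alpha_pi))// ler_pdivrMr// ler_peMr ?pi_ge0// ler1n.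
have zXE y : inner ((z *: X) *m y) y = z * inner (X *m y) y.
  by rewrite -scalemxAl innerZl.
have rXA : rdot (X *m x) (X *m x) = rdot ((z *: X) *m x) ((z *: X) *m x).
  by rewrite /rdot -scalemxAl innerZl innerZr mulrA -normCK z1 expr1n mul1r.
have Xsec y : y != 0 -> 0 < complex.Re (inner ((z *: X) *m y) y) /\
    `|complex.Im (inner ((z *: X) *m y) y)|
      <= tan alpha * complex.Re (inner ((z *: X) *m y) y).
  move=> y0; have [c /sX[c0 c1] ->] := numrange_homogeneous (z *: X) y y0.
  have y0' := rdot_gt0 _ y0.
  rewrite ReZ ImZ normrM (gtr0_norm y0') mulrCA (ler_pM2l y0').
  by split; [exact: mulr_gt0 | exact: c1].
rewrite rXA exprMn /sec exprVn cos2_tan2; last by rewrite (gt_eqF cos0).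
apply: rdot_mulmx_le_of_sector tan0 _ _ _ => y.
- by case/Xsec.
- have [->|/Xsec[]//] := eqVneq y 0.
  by rewrite mulmx0 inner0l normr0 mulr0.
- apply: le_trans (inner_mulmx_le_numradius X y).
  by apply: le_trans (Re_le_norm _) _; rewrite zXE normrM z1 mul1r.
Qed.

(** Cauchy-Schwarz at unit vectors; the hypothesis expresses $\|X\| \le c$ in squared form. *)
Lemma numradius_sqr_le X (c : R) : 0 <= c ->
  (forall x, rdot (X *m x) (X *m x) <= c ^+ 2 * rdot x x) -> numradius X <= c.
Proof.
move=> c0 Xc; rewrite /numradius.
have [Xn0|/nonemptyPn ->] :=
  pselect ([set complex.Re `|z| | z in numrange X] !=set0); last by rewrite sup0.
apply: ge_sup Xn0 _ => _ [_ [x x1 <-] <-].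
have xx : inner x x = 1.
  by rewrite -[LHS]sqrtCK -/(euclidean_norm x) x1 expr1n.
rewrite -(@ler_pXn2r _ 2)// ?nnegrE ?Re_norm_ge0// -lecR rmorphXn /= -normRe.
apply: le_trans (inner_CauchySchwarz _ _) _; rewrite xx mulr1 inner_rdot lecR.
by apply: le_trans (Xc x) _; rewrite /rdot xx mulr1.
Qed.

End NumericalRadius.

Theorem theorem2p1 (R : realType) (n : nat) (alpha1 alpha2 : R)
    (halpha1 : 0 <= alpha1 < pi / 2) (halpha2 : 0 <= alpha2 < pi / 2)
    (X Y : 'M[R[i]]_n)
    (hX : sectorial alpha1 X) (hY : sectorial alpha2 Y) :
  numradius (X *m Y) <= sec alpha1 * sec alpha2 * numradius X * numradius Y.
Proof.
have sec_ge0 (a : R) : 0 <= a < pi / 2 -> 0 <= sec a.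
  by move=> /cos_gt0_quadrant/ltW; rewrite invr_ge0.
have sX := sec_ge0 _ halpha1; have sY := sec_ge0 _ halpha2.
have wX := numradius_ge0 X; have wY := numradius_ge0 Y.
(* Pair each secant with its own numerical radius, then apply the bound for [X] at the vector $Yx$
   and the bound for [Y] at $x$. *)
rewrite -mulrA mulrACA.
apply: numradius_sqr_le => [|x].
  exact: (mulr_ge0 (mulr_ge0 sX wX) (mulr_ge0 sY wY)).
rewrite -mulmxA exprMn -mulrA.
apply: le_trans (sectorial_rdot_mulmx_le _ _ _ halpha1 hX) _.
rewrite ler_wpM2l ?sqr_ge0//.
exact: sectorial_rdot_mulmx_le halpha2 hY.
Qed.
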